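(* Let $R$ be a finite commutative ring with identity $1 \neq 0$, and suppose $|R| = l$. Then $$P(R) \geq \frac{2l + |Z(R)| - 1}{l^2},$$ where $Z(R)$ is the set of nonzero zero-divisors of $R$.
   Context: For a finite ring $R$, $P(R)$ denotes the probability that two elements of $R$ chosen at random (with replacement) have product zero, i.e. $P(R) = \frac{|Ann|}{|R\times R|}$, where $Ann = \{(x,y) \in R\times R : xy = 0\}$. $Z(R)$ denotes the set of nonzero zero-divisors of $R$, i.e. the nonzero $x \in R$ for which there exists a nonzero $y\in R$ with $xy=0$; in particular $0 \notin Z(R)$. *)

(* Defs.v *)
From mathcomp Require Import all_boot all_order all_algebra.

Set Implicit Arguments.
Unset Strict Implicit.
Unset Printing Implicit Defensive.

Import GRing.Theory.
Local Open Scope ring_scope.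

Definition Ann (R : finPzRingType) : {set R * R} :=
  [set xy : R * R | xy.1 * xy.2 == 0].

Definition zero_prod_prob (R : finPzRingType) : rat :=
  #|Ann R|%:R / #|[set: R * R]|%:R.

(* Only nonzero elements are counted, so 0 is not in this set. *)
Definition zero_divisors (R : finPzRingType) : {set R} :=
  [set x : R | (x != 0) && [exists y : R, (y != 0) && (x * y == 0)]].

(* Main.v *)
(* Every fibre {y | x * y = 0} of Ann over a nonzero x contains 0, and a second
   element when x is a zero-divisor; the fibre over 0 is all of R. *)
Require Import Defs.
From mathcomp Require Import all_boot all_order all_algebra.

Set Implicit Arguments.
Unset Strict Implicit.
Unset Printing Implicit Defensive.

Import Order.TTheory GRing.Theory Num.Theory.
Local Open Scope ring_scope.

(** Count [Ann R] by its first coordinate. With l = |R|, the fibre over 0 contributes l, and the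
    other l - 1 fibres contribute at least 1 each, plus 1 more for each zero-divisor
    ([card_annihilator_ge]). The total is at least 2l + |Z(R)| - 1; divide by l^2. *)

Lemma card_Ann (R : finPzRingType) :
  #|Ann R| = (\sum_(x : R) #|[set y : R | (x * y == 0)%R]|)%N.
Proof.
under eq_bigr => x _ do rewrite -sum1_card.
rewrite -sum1_card pair_big_dep /=.
by apply: eq_bigl => -[x y]; rewrite !inE.
Qed.

Lemma card_annihilator_ge (R : finPzRingType) (x : R) : x != 0 ->
  (1 + (x \in zero_divisors R) <= #|[set y : R | (x * y == 0)%R]|)%N.
Proof.
move=> x0; have zin : 0 \in [set y : R | x * y == 0] by rewrite inE mulr0.
rewrite (cardsD1 0) zin leq_add2l inE x0 /=.
case: existsP => // -[y /andP[y0 xy0]].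
by rewrite card_gt0; apply/set0Pn; exists y; rewrite !inE y0.
Qed.

(** The 1 is added on the right because subtraction in [nat] truncates; it becomes the -1 of the
    theorem in [rat]. *)
Lemma card_Ann_ge (R : finPzRingType) :
  (2 * #|R| + #|zero_divisors R| <= #|Ann R| + 1)%N.
Proof.
rewrite card_Ann (bigD1 0) //=.
have -> : [set y : R | 0 * y == 0] = [set: R].
  by apply/setP => y; rewrite !inE mul0r eqxx.
rewrite cardsT mul2n -addnn -addnA -addnA leq_add2l.
have -> : (#|R| + #|zero_divisors R| =
    \sum_(x : R | x != 0%R) (1 + (x \in zero_divisors R)) + 1)%N.
  rewrite big_split /= sum1_card addnAC addn1 -(cardC (pred1 (0 : R))) card1.
  congr (_.+1 + _)%N.
  (* As 0 is not in [zero_divisors R], summing its indicator over nonzero x only still gives its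
     cardinality. *)
  rewrite -sum1_card big_mkcond [RHS]big_mkcond /=.
  by apply: eq_bigr => x _; rewrite inE; case: (x != 0) => //=; case: [exists _, _].
by rewrite leq_add2r leq_sum // => x; apply: card_annihilator_ge.
Qed.

Theorem theorem2p1 (R : finComNzRingType) (l : nat) (hl : #|R| = l) :
  zero_prod_prob R >= (2 * l%:R + #|zero_divisors R|%:R - 1) / l%:R ^+ 2.
Proof.
rewrite /zero_prod_prob cardsT card_prod hl natrM -expr2.
apply: ler_wpM2r; first by rewrite invr_ge0 exprn_ge0.
by rewrite lerBlDr -hl -natrM -natrD -[1]/(1%:R) -natrD ler_nat card_Ann_ge.
Qed.
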